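(* Let $a$ and $b$ be $C^1$ functions of one variable with nowhere vanishing first derivatives, and consider the parameter transformation $$u=a(x+y),\qquad v=b(x-y),$$ which is locally invertible in a neighborhood of the initial curve $y=0$. Denote its (local) inverse by $$x=H(u,v),\qquad y=H^{*}(u,v).$$ Define functions $E(u,v)$ and $G(u,v)$ by $$E(u,v)=\tfrac12\bigl(a'(x+y)\bigr)^{-2},\qquad G(u,v)-1=\tfrac12\bigl(b'(x-y)\bigr)^{-2},$$ where $x=H(u,v)$, $y=H^{*}(u,v)$. Then $$X(u,v)=H(u,v)\,\mathbf{i}+H^{*}(u,v)\,\mathbf{j}+v\,\mathbf{k}$$ is an isometric embedding in $E^3$ of the metric $\omega=E\,du^2+G\,dv^2$.
   Context: $E^3$ is three-dimensional Euclidean space with orthonormal basis $\mathbf{i},\mathbf{j},\mathbf{k}$. A prime denotes the first derivative. ''Isometric embedding'' of $\omega$ is meant in the local sense: $X$ is a regular parametrized surface whose induced metric is $\omega$, i.e. $X_u\cdot X_u=E$, $X_u\cdot X_v=0$, $X_v\cdot X_v=G$ (subscripts denoting partial derivatives). *)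

(* Defs.v *)
From HB Require Import structures.
From mathcomp Require Import all_boot all_order all_algebra.
From mathcomp Require Import all_classical all_reals all_analysis.

Set Implicit Arguments.
Unset Strict Implicit.
Unset Printing Implicit Defensive.

Import Order.TTheory GRing.Theory Num.Theory.
Import numFieldNormedType.Exports.

Local Open Scope classical_set_scope.
Local Open Scope ring_scope.

Definition C1_on (R : realType) (A : set R) (f : R -> R) : Prop :=
  forall t, A t -> derivable f t 1 /\ {for t, continuous (derive1 f)}.

(* The parameter transformation (x, y) |-> (u, v). *)
Definition param (R : realType) (a b : R -> R) (p : R * R) : R * R :=
  (a (p.1 + p.2), b (p.1 - p.2)).

(* Natural domain of [param a b] when a is given on A and b on B. *)
Definition param_dom (R : realType) (A B : set R) : set (R * R) :=
  [set p | A (p.1 + p.2) /\ B (p.1 - p.2)].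

(* (H, Hs) : W -> U is the inverse of the restriction Phi : U -> W, where
   U and W are open. *)
Definition local_inverse (R : realType) (Phi : R * R -> R * R)
    (U W : set (R * R)) (H Hs : R * R -> R) : Prop :=
  [/\ open U, open W,
      forall p, U p -> W (Phi p) /\ (H (Phi p), Hs (Phi p)) = p
    & forall w, W w -> U (H w, Hs w) /\ Phi (H w, Hs w) = w].

Section Surfaces.
Variable R : realType.

Definition e_i : 'rV[R]_3 := delta_mx 0 0.
Definition e_j : 'rV[R]_3 := delta_mx 0 1.
Definition e_k : 'rV[R]_3 := delta_mx 0 2.

Definition dot (x y : 'rV[R]_3) : R := \sum_(l < 3) x 0 l * y 0 l.

Definition partial_u (X : R * R -> 'rV[R]_3) : R * R -> 'rV[R]_3 :=
  'D_((1, 0) : R * R) X.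
Definition partial_v (X : R * R -> 'rV[R]_3) : R * R -> 'rV[R]_3 :=
  'D_((0, 1) : R * R) X.

(* C^1, with X_u and X_v linearly independent at every point of W. *)
Definition regular_surface (W : set (R * R)) (X : R * R -> 'rV[R]_3) : Prop :=
  forall w, W w ->
    [/\ differentiable X w,
        {for w, continuous (partial_u X)},
        {for w, continuous (partial_v X)}
      & row_free (col_mx (partial_u X w) (partial_v X w))].

(* Local sense: X need not be injective; the metric is E du^2 + G dv^2. *)
Definition isometric_embedding (W : set (R * R)) (E G : R * R -> R)
    (X : R * R -> 'rV[R]_3) : Prop :=
  regular_surface W X /\
  forall w, W w ->
    [/\ dot (partial_u X w) (partial_u X w) = E w,
        dot (partial_u X w) (partial_v X w) = 0
      & dot (partial_v X w) (partial_v X w) = G w].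

End Surfaces.

(* Main.v *)
Require Import Defs.
From HB Require Import structures.
From mathcomp Require Import all_boot all_order all_algebra.
From mathcomp Require Import all_classical all_reals all_analysis.
From mathcomp Require Import ring.

(* In the characteristic coordinates s = x + y, t = x - y the transformation
   decouples into u = a s, v = b t, so its local inverses come from the
   one-variable inverses of a and b (injective on intervals by Rolle).  An
   arbitrary local inverse (H, Hs), not assumed continuous, must agree near
   each point with the one built from these; hence H + Hs and H - Hs are
   differentiable with differentials du / a' and dv / b', which gives
   X_u = (i + j) / (2 a') and X_v = (i - j) / (2 b') + k. *)

Set Implicit Arguments.
Unset Strict Implicit.
Unset Printing Implicit Defensive.

Import Order.TTheory GRing.Theory Num.Theory.
Import numFieldNormedType.Exports.

Local Open Scope classical_set_scope.
Local Open Scope ring_scope.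

(** The first-order expansion at [x] only involves values near [x], so the expansion of [f] is also
    one of [g], and uniqueness of the differential gives ['d g x = 'd f x]. *)
Lemma near_eq_differentiable (R : numFieldType) (V W : normedModType R)
    (f g : V -> W) (x : V) :
  (\near x, f x = g x) -> differentiable f x -> differentiable g x.
Proof.
move=> fg df.
have gE : g \o shift x = cst (g x) + 'd f x +o_ 0 id.
  have /eqaddoP fE := diff_locally df.
  apply/eqaddoP => e e0; move: (fE e e0).
  have fg0 : \forall h \near 0, f (h + x) = g (h + x).
    by move: fg; rewrite (near_shift 0 x);
      apply: filterS => h /=; rewrite subr0.
  apply: filter_app; near=> h.
  rewrite !fctE /= -(nbhs_singleton fg).
  by have -> : g (h + x) = f (h + x) by apply/esym; near: h.
have dgE : 'd g x = 'd f x :> (V -> W).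
  by apply: diff_unique => //; exact: diff_continuous.
by apply/diff_locallyP; rewrite dgE; split => //; exact: diff_continuous.
Unshelve. all: by end_near. Qed.

Lemma near_eq_is_diff (R : numFieldType) (V W : normedModType R)
    (f g df : V -> W) (x : V) :
  (\near x, f x = g x) -> is_diff x f df -> is_diff x g df.
Proof.
move=> fg [dfx <-].
have dgx := near_eq_differentiable fg dfx.
apply: DiffDef => //; apply/funext => v.
by rewrite -!deriveE//; apply: near_eq_derive; apply: filterS fg.
Qed.

(** * Local inversion of a function of one variable with nonzero derivative *)

Section local_inverse_1d.
Variables (R : realType) (A : set R) (f : R -> R).
Hypotheses (openA : open A) (C1f : C1_on A f).
Hypothesis (df_neq0 : forall t, A t -> derive1 f t != 0).

Lemma C1_on_continuous_near s : A s -> {near s, continuous f}.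
Proof.
move=> As; near=> t.
apply: differentiable_continuous; apply/derivable1_diffP.
by apply: (C1f _).1; near: t; exact: open_nbhs_nbhs.
Unshelve. all: by end_near. Qed.

(** A repeated value would give, by Rolle, a zero of the derivative between the two points. *)
Lemma itv_inj_derive1_neq0 l r : `]l, r[ `<=` A ->
  {in `]l, r[ &, injective f}.
Proof.
move=> lrA.
have lt_neq s t : s \in `]l, r[ -> t \in `]l, r[ -> s < t -> f s <> f t.
  move=> slr tlr st fst.
  have stA u : u \in `[s, t] -> A u.
    rewrite in_itv/= => /andP[su ut]; apply: lrA; rewrite /= in_itv/=.
    move: slr tlr; rewrite !in_itv/= => /andP[ls _] /andP[_ tr].
    by rewrite (lt_le_trans ls su) (le_lt_trans ut tr).
  have [||c cst dfc] := @Rolle _ f s t st _ _ fst.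
  - by move=> u ust; apply: (C1f _).1; apply: stA; exact: subset_itv_oo_cc.
  - apply: derivable_within_continuous => u ust.
    by apply: (C1f _).1; exact: stA.
  have := df_neq0 (stA _ (subset_itv_oo_cc cst)).
  by rewrite derive1E (@derive_val _ _ _ _ _ _ _ dfc) eqxx.
move=> s t slr tlr fst; have [st|ts|//] := ltgtP s t.
- by have := lt_neq _ _ slr tlr st fst.
- by have := lt_neq _ _ tlr slr ts (esym fst).
Qed.

Lemma C1_local_inverse s : A s -> exists (g : R -> R) (I : set R),
  [/\ open I, I s, I `<=` A & forall t, I t -> g (f t) = t].
Proof.
move=> As.
have [/= e e0 seA] := open_nbhs_nbhs (conj openA As).
have IA : `]s - e, s + e[ `<=` A by rewrite -ball_itv.
have injf := itv_inj_derive1_neq0 IA.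
(* The preimage inside the interval is unique by injectivity; off the image [get] returns a default
   value, about which nothing is claimed. *)
exists (fun u => get [set t | f t = u /\ t \in `]s - e, s + e[ ]).
exists `]s - e, s + e[%classic; split => //.
- by rewrite -ball_itv; exact: ballxx.
- move=> t It; case: (@getPex _ [set u | f u = f t /\ u \in `]s - e, s + e[ ]).
    by exists t.
  by move=> ftu Iu; exact: injf.
Qed.

Section inverse_on.
Variables (g : R -> R) (I : set R).
Hypotheses (openI : open I) (IA : I `<=` A) (fK : forall t, I t -> g (f t) = t).

Let near_fK t : I t -> {near t, cancel f g}.
Proof.
by move=> It; near=> u; apply: fK; near: u; exact: open_nbhs_nbhs.
Unshelve. all: by end_near. Qed.

(** The left inverse of a continuous function of one variable is also a right inverse near [f t] and
    is continuous at [f t], so its values stay in the open set [I]. This later yields openness of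
    the images of [a] and [b]. *)
Lemma near_image_C1 t : I t -> \forall u \near f t, I (g u) /\ f (g u) = u.
Proof.
move=> It.
have [gc gK] := near_can_continuousAcan_sym (near_fK It)
  (C1_on_continuous_near (IA It)).
near=> u; split; last by near: u.
near: u; apply: (nbhs_singleton gc); rewrite fK//.
exact: open_nbhs_nbhs.
Unshelve. all: by end_near. Qed.

Lemma is_derive_C1_inverse t : I t -> is_derive (f t) 1 g (derive1 f t)^-1.
Proof.
move=> It; apply: is_derive_inverse.
- exact: near_fK.
- exact: C1_on_continuous_near (IA It).
- by rewrite derive1E; apply/derivableP; exact: (C1f (IA It)).1.
- exact/df_neq0/IA.
Qed.

End inverse_on.
End local_inverse_1d.

(** The transposes of the two rows, each divided by its squared norm, form a right inverse. *)
Lemma row_free_orthogonal (R : realType) (u v : 'rV[R]_3) :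
  dot u u != 0 -> dot v v != 0 -> dot u v = 0 -> row_free (col_mx u v).
Proof.
have dotE (x y : 'rV[R]_3) : x *m y^T = (dot x y)%:M.
  rewrite [LHS]mx11_scalar !mxE; congr (_%:M).
  by apply: eq_bigr => l _; rewrite mxE.
have dotC (x y : 'rV[R]_3) : dot x y = dot y x.
  by apply: eq_bigr => l _; rewrite mulrC.
move=> uu vv uv; apply/row_freeP.
exists (row_mx ((dot u u)^-1 *: u^T) ((dot v v)^-1 *: v^T)).
rewrite mul_col_row -!scalemxAr !dotE (dotC v u) uv !scale_scalar_mx.
by rewrite !mulVf// !mulr0 raddf0 -scalar_mx_block.
Qed.

Lemma is_diff_fst (R : numFieldType) (V W : normedModType R) (w : V * W) :
  is_diff w fst fst.
Proof.
have c : continuous (fst : V * W -> V) by move=> z; exact: cvg_fst.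
apply: DiffDef; first exact: linear_differentiable.
by rewrite diff_lin.
Qed.

Lemma is_diff_snd (R : numFieldType) (V W : normedModType R) (w : V * W) :
  is_diff w snd snd.
Proof.
have c : continuous (snd : V * W -> W) by move=> z; exact: cvg_snd.
apply: DiffDef; first exact: linear_differentiable.
by rewrite diff_lin.
Qed.

Lemma is_derive_is_diff (R : realType) (f : R -> R) (x c : R) :
  is_derive x 1 f c -> is_diff x f (fun h => h * c).
Proof.
move=> dfx; have df : differentiable f x.
  by apply/derivable1_diffP; exact: ex_derive.
apply: DiffDef => //; apply/funext => h.
by rewrite diff1E// derive1E derive_val.
Qed.

(** * Local inverses of the parameter transformation *)

Section inverse_param.
Variables (R : realType) (A B : set R) (a b : R -> R).
Hypotheses (openA : open A) (openB : open B).
Hypotheses (C1a : C1_on A a) (C1b : C1_on B b).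
Hypotheses (da_neq0 : forall t, A t -> derive1 a t != 0).
Hypotheses (db_neq0 : forall t, B t -> derive1 b t != 0).

Let half_sumK (s t : R) : 2^-1 * (s + t) + 2^-1 * (s - t) = s.
Proof. by field. Qed.

Let half_diffK (s t : R) : 2^-1 * (s + t) - 2^-1 * (s - t) = t.
Proof. by field. Qed.

Let continuous_sum : continuous (fun p : R * R => p.1 + p.2).
Proof. by move=> p; apply: cvgD; [exact: cvg_fst|exact: cvg_snd]. Qed.

Let continuous_diff : continuous (fun p : R * R => p.1 - p.2).
Proof. by move=> p; apply: cvgB; [exact: cvg_fst|exact: cvg_snd]. Qed.

Lemma open_param_dom (I J : set R) : open I -> open J -> open (param_dom I J).
Proof.
move=> oI oJ; apply: openI.
- by apply: (@open_comp _ _ (fun p : R * R => p.1 + p.2)).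
- by apply: (@open_comp _ _ (fun p : R * R => p.1 - p.2)).
Qed.

Lemma local_inverse_exists p : param_dom A B p ->
  exists (U W : set (R * R)) (H Hs : R * R -> R),
    [/\ U p, U `<=` param_dom A B & local_inverse (param a b) U W H Hs].
Proof.
case=> As Bt.
have [g [I [oI Is IA gK]]] := C1_local_inverse openA C1a da_neq0 As.
have [k [J [oJ Jt JB kK]]] := C1_local_inverse openB C1b db_neq0 Bt.
(* In the coordinates [x + y], [x - y] the domain is the rectangle [I] times [J], and its image is
   the product of the images of [I] and [J]. *)
exists (param_dom I J), [set w | (a @` I) w.1 /\ (b @` J) w.2].
exists (fun w => 2^-1 * (g w.1 + k w.2)), (fun w => 2^-1 * (g w.1 - k w.2)).
have open_image (f h : R -> R) (K : set R) :
    (forall t, K t -> \forall u \near f t, K (h u) /\ f (h u) = u) ->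
    open (f @` K).
  move=> fh; rewrite openE => _ [t Kt <-].
  by apply: filterS (fh t Kt) => u [Khu <-]; exists (h u).
split => //.
- by move=> q [Iq Jq]; split; [exact: IA|exact: JB].
- split => //.
  + exact: open_param_dom.
  + apply: openI.
      apply: (@open_comp _ _ fst (a @` I)); first by move=> w _; exact: cvg_fst.
      exact: open_image (near_image_C1 openA C1a oI IA gK).
    apply: (@open_comp _ _ snd (b @` J)); first by move=> w _; exact: cvg_snd.
    exact: open_image (near_image_C1 openB C1b oJ JB kK).
  + move=> q [Iq Jq]; split.
      by split; [exists (q.1 + q.2)|exists (q.1 - q.2)].
    rewrite /= gK// kK//; case: q {Iq Jq} => x y /=.
    by congr pair; field.
  + move=> [u v] [/= [s Is' <-] [t Jt' <-]].
    by rewrite /param_dom /param /= half_sumK half_diffK gK// kK.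
Qed.

Section given_inverse.
Variables (U W : set (R * R)) (H Hs : R * R -> R).
Hypotheses (UAB : U `<=` param_dom A B)
  (inv : local_inverse (param a b) U W H Hs).

(** The explicit inverse [q] built from [g] and [k] has the stated differentials; they pass to
    [(H, Hs)] once the two maps are shown to agree near [w]. *)
Lemma is_diff_sum_diff w : W w ->
  is_diff w (H \+ Hs) (fun h => h.1 * (derive1 a (H w + Hs w))^-1) /\
  is_diff w (H \- Hs) (fun h => h.2 * (derive1 b (H w - Hs w))^-1).
Proof.
have [openU openW HK KH] := inv => Ww.
have [Uw Phiw] := KH _ Ww.
have [/= As Bt] := UAB Uw.
have [g [I [oI Is IA gK]]] := C1_local_inverse openA C1a da_neq0 As.
have [k [J [oJ Jt JB kK]]] := C1_local_inverse openB C1b db_neq0 Bt.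
have dg := is_derive_C1_inverse openA C1a da_neq0 oI IA gK Is.
have dk := is_derive_C1_inverse openB C1b db_neq0 oJ JB kK Jt.
have gw := near_image_C1 openA C1a oI IA gK Is.
have kw := near_image_C1 openB C1b oJ JB kK Jt.
have [aw bw] : a (H w + Hs w) = w.1 /\ b (H w - Hs w) = w.2.
  by split; rewrite -{3}Phiw.
have gsw : g w.1 = H w + Hs w by rewrite -aw gK.
have ksw : k w.2 = H w - Hs w by rewrite -bw kK.
rewrite aw in dg gw; rewrite bw in dk kw.
have dg1 : is_diff w (g \o fst) (fun h => h.1 * (derive1 a (H w + Hs w))^-1).
  have := is_diff_fst w => d1; have := is_derive_is_diff dg => d2.
  exact: (is_diff_comp d1 d2).
have dk1 : is_diff w (k \o snd) (fun h => h.2 * (derive1 b (H w - Hs w))^-1).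
  have := is_diff_snd w => d1; have := is_derive_is_diff dk => d2.
  exact: (is_diff_comp d1 d2).
pose q z := (2^-1 * (g z.1 + k z.2), 2^-1 * (g z.1 - k z.2)).
have qw : q w = (H w, Hs w).
  by rewrite /q gsw ksw; congr pair; field.
have qc : {for w, continuous q}.
  have gc : {for w, continuous (g \o fst)}
    by apply: differentiable_continuous; exact: ex_diff.
  have kc : {for w, continuous (k \o snd)}
    by apply: differentiable_continuous; exact: ex_diff.
  exact: (cvg_pair (cvgM (cvg_cst _) (cvgD gc kc))
                   (cvgM (cvg_cst _) (cvgB gc kc))).
(* Continuity of [q] at [w] alone keeps [q z] in the open set [U], where [(H, Hs)] is known to undo
   the transformation. *)
have qU : \forall z \near w, U (q z).
  by apply: qc; rewrite qw; exact: open_nbhs_nbhs.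
have near_fst : \forall z \near w, a (g z.1) = z.1.
  have fc : fst z @[z --> w] --> w.1 by exact: cvg_fst.
  by apply: (fc (fun u => a (g u) = u)); apply: filterS gw => ? [].
have near_snd : \forall z \near w, b (k z.2) = z.2.
  have sc : snd z @[z --> w] --> w.2 by exact: cvg_snd.
  by apply: (sc (fun v => b (k v) = v)); apply: filterS kw => ? [].
(* Since [q z] lies in [U] and is sent to [z] by the transformation, the left-inverse property of
   [(H, Hs)] on [U] forces equality. *)
have qE : \forall z \near w, (H z, Hs z) = q z.
  near=> z.
  have az : a (g z.1) = z.1 by near: z.
  have bz : b (k z.2) = z.2 by near: z.
  have Uqz : U (q z) by near: z.
  have [_] := HK _ Uqz.
  by rewrite /param /= half_sumK half_diffK az bz -surjective_pairing.
split.
- apply: near_eq_is_diff dg1; apply: filterS qE => z [Hz Hsz].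
  by rewrite /= Hz Hsz half_sumK.
- apply: near_eq_is_diff dk1; apply: filterS qE => z [Hz Hsz].
  by rewrite /= Hz Hsz half_diffK.
Unshelve. all: by end_near. Qed.

(** * The surface, its partial derivatives and its induced metric *)

Let X (w : R * R) : 'rV[R]_3 := H w *: e_i R + Hs w *: e_j R + w.2 *: e_k R.
Let Xu (w : R * R) : 'rV[R]_3 :=
  (2^-1 * (derive1 a (H w + Hs w))^-1) *: (e_i R + e_j R).
Let Xv (w : R * R) : 'rV[R]_3 :=
  (2^-1 * (derive1 b (H w - Hs w))^-1) *: (e_i R - e_j R) + e_k R.

Lemma is_diff_position w :
  W w -> is_diff w X (fun h => h.1 *: Xu w + h.2 *: Xv w).
Proof.
move=> Ww; have [dS dT] := is_diff_sum_diff Ww.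
have scale_diff (f df : R * R -> R) (e : 'rV[R]_3) :
    is_diff w f df -> is_diff w (fun z => f z *: e) (fun h => df h *: e).
  by move=> dfw; exact: (is_diff_comp dfw (is_diff_scalel _ e)).
have dSw := scale_diff _ _ (2^-1 *: (e_i R + e_j R)) dS.
have dTw := scale_diff _ _ (2^-1 *: (e_i R - e_j R)) dT.
have dkw := scale_diff _ _ (e_k R) (is_diff_snd w).
(* Passing to the orthogonal directions [e_i + e_j] and [e_i - e_j] makes the coefficients exactly
   the functions whose differentials are known. *)
have -> : X = (fun z => (H \+ Hs) z *: (2^-1 *: (e_i R + e_j R))) +
              (fun z => (H \- Hs) z *: (2^-1 *: (e_i R - e_j R))) +
              (fun z => z.2 *: e_k R).
  by apply/funext => z; apply/rowP => l; rewrite !fctE !mxE /=; field.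
apply: is_diff_eq (is_diffD (is_diffD dSw dTw) dkw) _.
by apply/funext => h; apply/rowP => l; rewrite !fctE !mxE /=; ring.
Qed.

Lemma partial_position w : W w -> partial_u X w = Xu w /\ partial_v X w = Xv w.
Proof.
move=> Ww; have [dX dXE] := is_diff_position Ww.
by rewrite /partial_u /partial_v !deriveE// dXE /=
  !(scale0r, scale1r) addr0 add0r.
Qed.

Lemma dot_partials w :
  [/\ dot (Xu w) (Xu w) = 2^-1 * (derive1 a (H w + Hs w)) ^- 2,
      dot (Xu w) (Xv w) = 0
    & dot (Xv w) (Xv w) = 1 + 2^-1 * (derive1 b (H w - Hs w)) ^- 2].
Proof.
(* With the reciprocals of the derivatives abstracted to [p] and [q], the three claims are
   identities polynomial in [p] and [q]. *)
rewrite -!exprVn /Xu /Xv; move: (_ a _)^-1 (_ b _)^-1 => p q.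
by rewrite /dot !big_ord_recl !big_ord0 !mxE /=; split; field.
Qed.

Lemma continuous_partials w :
  W w -> {for w, continuous Xu} /\ {for w, continuous Xv}.
Proof.
move=> Ww; have [dS dT] := is_diff_sum_diff Ww.
have [openU openW HK KH] := inv; have [Uw _] := KH _ Ww.
have [/= As Bt] := UAB Uw.
have Sc : {for w, continuous (H \+ Hs)}.
  by apply: differentiable_continuous; exact: ex_diff.
have Tc : {for w, continuous (H \- Hs)}.
  by apply: differentiable_continuous; exact: ex_diff.
have ac : {for w, continuous (fun z => 2^-1 * (derive1 a (H z + Hs z))^-1)}.
  apply: cvgM; first exact: cvg_cst.
  apply: cvgV; first exact: da_neq0.
  exact: (continuous_comp Sc (C1a As).2).
have bc : {for w, continuous (fun z => 2^-1 * (derive1 b (H z - Hs z))^-1)}.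
  apply: cvgM; first exact: cvg_cst.
  apply: cvgV; first exact: db_neq0.
  exact: (continuous_comp Tc (C1b Bt).2).
split; first exact: cvgZr_tmp.
by apply: cvgD; [exact: cvgZr_tmp|exact: cvg_cst].
Qed.

Lemma isometric_embedding_position (E G : R * R -> R) :
  (forall w, W w -> E w = 2^-1 * (derive1 a (H w + Hs w)) ^- 2) ->
  (forall w, W w -> G w - 1 = 2^-1 * (derive1 b (H w - Hs w)) ^- 2) ->
  isometric_embedding W E G X.
Proof.
move=> Edef Gdef; have [_ openW _ KH] := inv.
split=> w Ww; have [Xuw Xvw] := partial_position Ww;
  have [uu uv vv] := dot_partials w; last first.
  by rewrite Xuw Xvw; split; rewrite ?Edef// vv -Gdef// addrC subrK.
have nearW : \forall z \near w, W z by exact: open_nbhs_nbhs.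
have [Uw _] := KH _ Ww; have [/= As Bt] := UAB Uw.
have [Xuc Xvc] := continuous_partials Ww.
split.
- by have [] := is_diff_position Ww.
(* The formula for [partial_u X] is known only on [W]; as [W] is open, it holds near [w], so
   continuity of [Xu] carries over. *)
- rewrite /prop_for /continuous_at Xuw; apply: cvg_trans Xuc.
  apply: near_eq_cvg; apply: filterS nearW => z Wz.
  by have [-> _] := partial_position Wz.
- rewrite /prop_for /continuous_at Xvw; apply: cvg_trans Xvc.
  apply: near_eq_cvg; apply: filterS nearW => z Wz.
  by have [_ ->] := partial_position Wz.
(* Regularity comes from the metric: the partials are orthogonal, the first squared norm is a
   nonzero multiple of an inverse square, and the second is at least 1. *)
- rewrite Xuw Xvw; apply: row_free_orthogonal => //.
    by rewrite uu mulf_neq0// ?invr_eq0 ?expf_neq0 ?da_neq0 ?pnatr_eq0.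
  by rewrite vv lt0r_neq0// ltr_wpDr// mulr_ge0// invr_ge0// exprn_even_ge0.
Qed.

End given_inverse.
End inverse_param.

Theorem theorem2 (R : realType) (A B : set R) (a b : R -> R)
    (openA : open A) (openB : open B)
    (C1a : C1_on A a) (C1b : C1_on B b)
    (da_neq0 : forall t, A t -> derive1 a t != 0)
    (db_neq0 : forall t, B t -> derive1 b t != 0) :
  (exists N : set (R * R),
     [/\ open N,
         forall x, A x -> B x -> N (x, 0),
         N `<=` param_dom A B
       & forall p, N p ->
           exists (U W : set (R * R)) (H Hs : R * R -> R),
             [/\ U p, U `<=` N & local_inverse (param a b) U W H Hs]]) /\
  (forall (U W : set (R * R)) (H Hs E G : R * R -> R),
     U `<=` param_dom A B ->
     local_inverse (param a b) U W H Hs ->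
     (forall w, W w -> E w = 2^-1 * (derive1 a (H w + Hs w)) ^- 2) ->
     (forall w, W w -> G w - 1 = 2^-1 * (derive1 b (H w - Hs w)) ^- 2) ->
     isometric_embedding W E G
       (fun w => H w *: e_i R + Hs w *: e_j R + w.2 *: e_k R)).
Proof.
split; last first.
  by move=> U W H Hs E G UAB inv; exact: (isometric_embedding_position
    openA openB C1a C1b da_neq0 db_neq0 UAB inv).
(* The whole domain serves as the neighborhood of the initial curve: local inverses exist at each of
   its points, not only at those with [y = 0]. *)
exists (param_dom A B); split => //.
- exact: open_param_dom.
- by move=> x Ax Bx; rewrite /param_dom /= addr0 subr0.
- by move=> p; exact: (local_inverse_exists openA openB C1a C1b da_neq0 db_neq0).
Qed.
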